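(* Work in $\mathrm{CZF}^-$. Let $\Phi$ be an abstract inductive definition on a $\bigvee$-semilattice $L$ set-generated by a set $B$. Then the smallest $\Phi$-closed class $\mathcal I(\Phi)$ exists.
   Context: $\mathrm{CZF}^-$ is the theory in first-order intuitionistic logic with equality, in the language of $\in$, with axioms and schemes: Extensionality; Pair; Union; Restricted Separation (only formulas all of whose quantifiers are of the form $\forall x\in b$, $\exists x\in c$); Infinity; Set Induction ($\forall a((\forall x\in a)\phi(x)\to\phi(a))\to\forall a\,\phi(a)$, for all $\phi$); Strong Collection ($\forall a((\forall x\in a)\exists y\,\phi(x,y)\to\exists b((\forall x\in a)(\exists y\in b)\phi(x,y)\wedge(\forall y\in b)(\exists x\in a)\phi(x,y)))$, for all $\phi$). Classes are given by formulas as usual; $\mathrm{Pow}(X)$ is the class of all subsets of $X$ (subsets are sets). A partially ordered class $(L,\leq)$ is a class with a reflexive, transitive, antisymmetric class relation. It is a $\bigvee$-semilattice if every subset of $L$ has a supremum. A $\bigvee$-semilattice $L$ is set-generated by $B$ (with generating set $B$) if $B$ is a subset of $L$ such that for all $x\in L$: (i) $\downarrow^B x=\{b\in B\mid b\leq x\}$ is a set; (ii) $x=\bigvee\downarrow^B x$. An abstract inductive definition on $L$ is any class of ordered pairs $\Phi\subseteq B\times L$. A subclass $Y\subseteq B$ is $c_L$-closed if for every subset $U$ of $Y$ one has $\downarrow^B\bigvee U\subseteq Y$. A class $Y\subseteq B$ is $\Phi$-closed if it is $c_L$-closed and, whenever $(b,a)\in\Phi$ and $\downarrow^B a\subseteq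 Y$, also $b\in Y$. $\mathcal I(\Phi)$ denotes the least (with respect to inclusion) $\Phi$-closed class, if it exists. *)

(* Defs.v *)
From Stdlib Require Import List.
Import ListNotations.

(** * First-order formulas in the language of sets

    De Bruijn syntax: the only terms are variables, and [All], [Ex] bind
    index [0].  Free variables play the role of parameters. *)

Inductive form : Type :=
| Eq (x y : nat)
| Mem (x y : nat)
| Bot
| And (f g : form)
| Or (f g : form)
| Imp (f g : form)
| All (f : form)
| Ex (f : form).

Definition up (r : nat -> nat) (k : nat) : nat :=
  match k with 0 => 0 | S i => S (r i) end.

Fixpoint ren (r : nat -> nat) (f : form) : form :=
  match f with
  | Eq x y => Eq (r x) (r y)
  | Mem x y => Mem (r x) (r y)
  | Bot => Bot
  | And f g => And (ren r f) (ren r g)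
  | Or f g => Or (ren r f) (ren r g)
  | Imp f g => Imp (ren r f) (ren r g)
  | All f => All (ren (up r) f)
  | Ex f => Ex (ren (up r) f)
  end.

Definition lift : form -> form := ren S.

(** [inst x f] replaces variable [0] of [f] by [x] and lowers the others. *)
Definition inst (x : nat) : form -> form :=
  ren (fun k => match k with 0 => x | S i => i end).

(** * Intuitionistic natural deduction with equality

    Members of [T] may have free variables.  Since [prv_allI] lifts the
    context but not [T], they act as their universal closures. *)

Inductive prv (T : form -> Prop) : list form -> form -> Prop :=
| prv_thy G f : T f -> prv T G f
| prv_hyp G f : In f G -> prv T G f
| prv_botE G f : prv T G Bot -> prv T G f
| prv_andI G f g : prv T G f -> prv T G g -> prv T G (And f g)
| prv_andE1 G f g : prv T G (And f g) -> prv T G f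
| prv_andE2 G f g : prv T G (And f g) -> prv T G g
| prv_orI1 G f g : prv T G f -> prv T G (Or f g)
| prv_orI2 G f g : prv T G g -> prv T G (Or f g)
| prv_orE G f g h :
    prv T G (Or f g) -> prv T (f :: G) h -> prv T (g :: G) h -> prv T G h
| prv_impI G f g : prv T (f :: G) g -> prv T G (Imp f g)
| prv_impE G f g : prv T G (Imp f g) -> prv T G f -> prv T G g
| prv_allI G f : prv T (map lift G) f -> prv T G (All f)
| prv_allE G f x : prv T G (All f) -> prv T G (inst x f)
| prv_exI G f x : prv T G (inst x f) -> prv T G (Ex f)
| prv_exE G f h :
    prv T G (Ex f) -> prv T (f :: map lift G) (lift h) -> prv T G h
| prv_eqI G x : prv T G (Eq x x)
| prv_eqE G f x y :
    prv T G (Eq x y) -> prv T G (inst x f) -> prv T G (inst y f).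

(** Restricted formulas.  The bound of a quantifier is [S b] in its scope,
    hence never the quantified variable. *)
Inductive restricted : form -> Prop :=
| restr_eq x y : restricted (Eq x y)
| restr_mem x y : restricted (Mem x y)
| restr_bot : restricted Bot
| restr_and f g : restricted f -> restricted g -> restricted (And f g)
| restr_or f g : restricted f -> restricted g -> restricted (Or f g)
| restr_imp f g : restricted f -> restricted g -> restricted (Imp f g)
| restr_all b f : restricted f -> restricted (All (Imp (Mem 0 (S b)) f))
| restr_ex b f : restricted f -> restricted (Ex (And (Mem 0 (S b)) f)).

(** * Writing formulas with named binders

    A [var] (resp. [pform]) yields a de Bruijn index (resp. a formula) when
    given the number [d] of enclosing binders.  A variable bound at depth [d]
    has index [d' - S d] at depth [d' > d]; parameter [i] has index [d + i] at
    depth [d].  The Unicode connectives below are those of the object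
    language. *)

Definition var : Type := nat -> nat.
Definition pform : Type := nat -> form.
Definition class : Type := var -> pform.

Definition par (i : nat) : var := fun d => d + i.

Definition fEq (x y : var) : pform := fun d => Eq (x d) (y d).
Definition fMem (x y : var) : pform := fun d => Mem (x d) (y d).
Definition fBot : pform := fun _ => Bot.
Definition fAnd (F G : pform) : pform := fun d => And (F d) (G d).
Definition fOr (F G : pform) : pform := fun d => Or (F d) (G d).
Definition fImp (F G : pform) : pform := fun d => Imp (F d) (G d).
Definition fIff (F G : pform) : pform := fAnd (fImp F G) (fImp G F).
Definition fAll (F : var -> pform) : pform :=
  fun d => All (F (fun d' => d' - S d) (S d)).
Definition fEx (F : var -> pform) : pform :=
  fun d => Ex (F (fun d' => d' - S d) (S d)).

Declare Scope pform_scope.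
Delimit Scope pform_scope with pform.
Bind Scope pform_scope with pform.

Notation "x ≐ y" := (fEq x y) (at level 70, no associativity) : pform_scope.
Notation "x ∈ y" := (fMem x y) (at level 70, no associativity) : pform_scope.
Notation "F ∧ G" := (fAnd F G) (at level 80, right associativity) : pform_scope.
Notation "F ∨ G" := (fOr F G) (at level 85, right associativity) : pform_scope.
Notation "F ↔ G" := (fIff F G) (at level 95, no associativity) : pform_scope.
Notation "F → G" := (fImp F G)
  (at level 99, G at level 200, right associativity) : pform_scope.
Notation "∀ x .. y , F" := (fAll (fun x => .. (fAll (fun y => F)) ..))
  (at level 200, x binder, y binder, right associativity) : pform_scope.
Notation "∃ x .. y , F" := (fEx (fun x => .. (fEx (fun y => F)) ..))
  (at level 200, x binder, y binder, right associativity) : pform_scope.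

Local Open Scope pform_scope.

(** The class [{x | f(x)}]: variable [0] of [f] is the element, variable
    [S i] is parameter [i]. *)
Definition cls (f : form) : class :=
  fun x d => ren (fun k => match k with 0 => x d | S i => d + i end) f.

(** Likewise for [f(x, y)]: variables [0], [1] are the arguments and variable
    [S (S i)] is parameter [i]. *)
Definition rel (f : form) (x y : var) : pform :=
  fun d => ren (fun k => match k with
                         | 0 => x d
                         | 1 => y d
                         | S (S i) => d + i
                         end) f.

(** * The theory CZF without Subset Collection *)

Definition empty (x : var) : pform := ∀ y, y ∈ x → fBot.

(** [y = x ∪ {x}] *)
Definition is_succ (x y : var) : pform := ∀ z, z ∈ y ↔ z ∈ x ∨ z ≐ x.

Definition Extensionality : pform :=
  ∀ a b, (∀ x, x ∈ a ↔ x ∈ b) → a ≐ b.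

Definition Pairing : pform :=
  ∀ a b, ∃ c, ∀ x, x ∈ c ↔ x ≐ a ∨ x ≐ b.

Definition Union : pform :=
  ∀ a, ∃ b, ∀ x, x ∈ b ↔ (∃ y, y ∈ a ∧ x ∈ y).

Definition Separation (f : form) : pform :=
  ∀ a, ∃ b, ∀ x, x ∈ b ↔ x ∈ a ∧ cls f x.

Definition Infinity : pform :=
  ∃ a, (∃ x, x ∈ a ∧ empty x) ∧ (∀ x, x ∈ a → ∃ y, y ∈ a ∧ is_succ x y).

Definition SetInduction (f : form) : pform :=
  (∀ a, (∀ x, x ∈ a → cls f x) → cls f a) → ∀ a, cls f a.

Definition StrongCollection (f : form) : pform :=
  ∀ a, (∀ x, x ∈ a → ∃ y, rel f x y) →
    ∃ b, (∀ x, x ∈ a → ∃ y, y ∈ b ∧ rel f x y) ∧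
         (∀ y, y ∈ b → ∃ x, x ∈ a ∧ rel f x y).

Inductive CZFm : form -> Prop :=
| ax_ext : CZFm (Extensionality 0)
| ax_pair : CZFm (Pairing 0)
| ax_union : CZFm (Union 0)
| ax_sep f : restricted f -> CZFm (Separation f 0)
| ax_inf : CZFm (Infinity 0)
| ax_ind f : CZFm (SetInduction f 0)
| ax_coll f : CZFm (StrongCollection f 0).

Definition CZFm_proves (F : pform) : Prop := prv CZFm [] (F 0).

(** * Set-generated join-semilattices and inductive definitions *)

Definition elems (a : var) : class := fun x => x ∈ a.

Definition subclass (A B : class) : pform := ∀ x, A x → B x.

Definition is_set (A : class) : pform := ∃ a, ∀ x, x ∈ a ↔ A x.

(** [c = {a, b}] *)
Definition is_upair (c a b : var) : pform := ∀ x, x ∈ c ↔ x ≐ a ∨ x ≐ b.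

(** [p = {{a}, {a, b}}] *)
Definition is_opair (p a b : var) : pform :=
  ∀ x, x ∈ p ↔ is_upair x a a ∨ is_upair x a b.

(** [(a, b) ∈ R] *)
Definition related (R : class) (a b : var) : pform :=
  ∃ p, is_opair p a b ∧ R p.

(** [R ⊆ A × B] *)
Definition sub_prod (R A B : class) : pform :=
  ∀ p, R p → ∃ a b, A a ∧ B b ∧ is_opair p a b.

Definition po_class (L le : class) : pform :=
  sub_prod le L L ∧
  (∀ x, L x → related le x x) ∧
  (∀ x y z, L x → L y → L z →
     related le x y → related le y z → related le x z) ∧
  (∀ x y, L x → L y → related le x y → related le y x → x ≐ y).

Definition is_sup (L le A : class) (s : var) : pform :=
  L s ∧ (∀ x, A x → related le x s) ∧
  (∀ t, L t → (∀ x, A x → related le x t) → related le s t).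

Definition join_semilattice (L le : class) : pform :=
  po_class L le ∧
  (∀ U, subclass (elems U) L → ∃ s, is_sup L le (elems U) s).

(** [↓^B x] *)
Definition down (le : class) (B x : var) : class :=
  fun b => b ∈ B ∧ related le b x.

Definition set_generated (L le : class) (B : var) : pform :=
  join_semilattice L le ∧
  subclass (elems B) L ∧
  (∀ x, L x → is_set (down le B x) ∧ is_sup L le (down le B x) x).

Definition inductive_definition (L : class) (B : var) (Phi : class) : pform :=
  sub_prod Phi (elems B) L.

Definition c_closed (L le : class) (B : var) (Y : class) : pform :=
  subclass Y (elems B) ∧
  (∀ U, subclass (elems U) Y →
     ∀ s, is_sup L le (elems U) s → subclass (down le B s) Y).

Definition Phi_closed (L le : class) (B : var) (Phi Y : class) : pform :=
  c_closed L le B Y ∧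
  (∀ b a, related Phi b a → subclass (down le B a) Y → Y b).

(* Main.v *)
(** Call a set [g] of pairs (stage, element) good if each of its elements is the
    conclusion of a rule whose premises occur in [g] at stages belonging to the
    given stage.  The elements occurring in some good set form the least class
    closed under the rules: unions of good sets are good, Strong Collection
    gathers good sets and stages for the premises of a rule into a single good
    set and a single new stage, and leastness is Set Induction on stages.
    [Phi]-closedness is closedness under such rules with a set of premises,
    because every [down le B a] is a set.

    Derivability in [CZFm] is handled as forcing, with contexts as worlds.
    Since variables are generic, quantifiers may be taken to range over the
    variables at every world. *)

From Stdlib Require Import List Lia PeanoNat.
Require Import Defs.
Import ListNotations.
Local Open Scope pform_scope.

(** * Renaming and generic variables *)

Lemma ren_ext (f : form) (r s : nat -> nat) :
  (forall k, r k = s k) -> ren r f = ren s f.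
Proof.
  revert r s; induction f; intros r s E; simpl; f_equal; auto;
    apply IHf; intros [|k]; simpl; auto.
Qed.

Lemma ren_id (f : form) (r : nat -> nat) : (forall k, r k = k) -> ren r f = f.
Proof.
  revert r; induction f; intros r E; simpl; f_equal; auto;
    apply IHf; intros [|k]; simpl; auto.
Qed.

Lemma ren_ren (f : form) (r s : nat -> nat) :
  ren s (ren r f) = ren (fun k => s (r k)) f.
Proof.
  revert r s; induction f; intros r s; simpl; f_equal; auto;
    rewrite IHf; apply ren_ext; intros [|k]; reflexivity.
Qed.

Lemma ren_inst (f : form) (r : nat -> nat) (x : nat) :
  ren r (inst x f) = inst (r x) (ren (up r) f).
Proof.
  unfold inst; rewrite !ren_ren; apply ren_ext; intros [|k]; reflexivity.
Qed.

Lemma ren_lift (f : form) (r : nat -> nat) :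
  ren (up r) (lift f) = lift (ren r f).
Proof. unfold lift; rewrite !ren_ren; reflexivity. Qed.

Lemma map_ren_lift (G : list form) (r : nat -> nat) :
  map (ren (up r)) (map lift G) = map lift (map (ren r) G).
Proof.
  rewrite !map_map; apply map_ext; intros f; apply ren_lift.
Qed.

Lemma restricted_ren (f : form) :
  restricted f -> forall r, restricted (ren r f).
Proof.
  induction 1; intros r; simpl; constructor; auto.
Qed.

Ltac ren_congruence :=
  unfold Separation, SetInduction, StrongCollection, fIff, fAll, fEx, fAnd,
    fImp, fMem, cls, rel; simpl; rewrite !ren_ren;
  repeat first [ reflexivity
               | apply ren_ext; intros [|[|k]]; reflexivity
               | f_equal ].

(** Renaming the parameters of an instance of a scheme gives the instance for the renamed formula.
    One [up] shields the argument of a class, two shield the arguments of a relation. *)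
Lemma CZFm_ren (f : form) (r : nat -> nat) : CZFm f -> CZFm (ren r f).
Proof.
  intros [ | | | g Hg | | g | g ].
  - exact ax_ext.
  - exact ax_pair.
  - exact ax_union.
  - replace (ren r (Separation g 0)) with (Separation (ren (up r) g) 0)
      by ren_congruence.
    apply ax_sep, restricted_ren, Hg.
  - exact ax_inf.
  - replace (ren r (SetInduction g 0)) with (SetInduction (ren (up r) g) 0)
      by ren_congruence.
    apply ax_ind.
  - replace (ren r (StrongCollection g 0))
      with (StrongCollection (ren (up (up r)) g) 0) by ren_congruence.
    apply ax_coll.
Qed.

(** With [r] taken to be [unfresh n], a derivation about a fresh variable [n] becomes a derivation
    about the variable to be bound. *)
Lemma prv_ren (G : list form) (f : form) (r : nat -> nat) :
  prv CZFm G f -> prv CZFm (map (ren r) G) (ren r f).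
Proof.
  intros H; revert r; induction H; intros r; simpl in *.
  - apply prv_thy, CZFm_ren; assumption.
  - apply prv_hyp, in_map; assumption.
  - apply prv_botE; auto.
  - apply prv_andI; auto.
  - eapply prv_andE1; eauto.
  - eapply prv_andE2; eauto.
  - apply prv_orI1; auto.
  - apply prv_orI2; auto.
  - eapply prv_orE; eauto.
  - apply prv_impI; auto.
  - eapply prv_impE; eauto.
  - apply prv_allI; rewrite <- map_ren_lift; auto.
  - rewrite ren_inst; apply prv_allE; auto.
  - apply prv_exI with (r x); rewrite <- ren_inst; auto.
  - apply prv_exE with (ren (up r) f); auto.
    rewrite <- map_ren_lift, <- ren_lift; auto.
  - apply prv_eqI.
  - rewrite ren_inst; apply prv_eqE with (r x); auto.
    rewrite <- ren_inst; auto.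
Qed.

Lemma prv_incl (T : form -> Prop) (G : list form) (f : form) :
  prv T G f -> forall G', incl G G' -> prv T G' f.
Proof.
  assert (Hc : forall (g : form) G G', incl G G' -> incl (g :: G) (g :: G')).
  { intros g G1 G2 I h [->|Hh]; simpl; auto. }
  induction 1; intros G' I.
  - apply prv_thy; assumption.
  - apply prv_hyp; auto.
  - apply prv_botE; auto.
  - apply prv_andI; auto.
  - eapply prv_andE1; eauto.
  - eapply prv_andE2; eauto.
  - apply prv_orI1; auto.
  - apply prv_orI2; auto.
  - eapply prv_orE; eauto.
  - apply prv_impI; auto.
  - eapply prv_impE; eauto.
  - apply prv_allI, IHprv, incl_map, I.
  - apply prv_allE; auto.
  - apply prv_exI with x; auto.
  - apply prv_exE with f; auto using incl_map.
  - apply prv_eqI.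
  - apply prv_eqE with x; auto.
Qed.

(** * Fresh variables *)

Fixpoint vars_below (n : nat) (f : form) : Prop :=
  match f with
  | Eq x y | Mem x y => x < n /\ y < n
  | Bot => True
  | And f g | Or f g | Imp f g => vars_below n f /\ vars_below n g
  | All f | Ex f => vars_below (S n) f
  end.

Lemma vars_below_le (f : form) (m n : nat) :
  m <= n -> vars_below m f -> vars_below n f.
Proof.
  revert m n; induction f; simpl; intros m n Hmn H; try lia;
    try (destruct H as [H1 H2]; split; [exact (IHf1 m n Hmn H1)|
                                        exact (IHf2 m n Hmn H2)]);
    exact (IHf (S m) (S n) (le_n_S m n Hmn) H).
Qed.

Lemma vars_below_bound (f : form) : exists n, vars_below n f.
Proof.
  induction f; simpl;
    try (destruct IHf1 as [m Hm], IHf2 as [n Hn]; exists (m + n); split;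
         (eapply vars_below_le; [|eassumption]; lia));
    try (destruct IHf as [n Hn]; exists n; eapply vars_below_le;
         [|eassumption]; lia).
  - exists (S (x + y)); lia.
  - exists (S (x + y)); lia.
  - exists 0; exact I.
Qed.

Lemma vars_below_bound_list (G : list form) :
  exists n, forall f, In f G -> vars_below n f.
Proof.
  induction G as [|g G [n Hn]].
  - exists 0; intros f [].
  - destruct (vars_below_bound g) as [m Hm]; exists (m + n).
    intros f [<-|Hf]; eapply vars_below_le; [|eassumption| |apply Hn, Hf]; lia.
Qed.

Lemma ren_ext_below (f : form) (n : nat) (r s : nat -> nat) :
  vars_below n f -> (forall k, k < n -> r k = s k) -> ren r f = ren s f.
Proof.
  revert n r s; induction f; simpl; intros n r s H E; f_equal;
    try (apply E; lia);
    try (eapply IHf1; [apply H|exact E]);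
    try (eapply IHf2; [apply H|exact E]); auto;
    (eapply IHf; [exact H|]; intros [|k] Hk; simpl; auto;
     rewrite E; auto; lia).
Qed.

(** Binding a fresh [n]: it becomes index [0] and every other variable is shifted, so formulas whose
    free variables are below [n] are just lifted. *)
Definition unfresh (n k : nat) : nat := if k =? n then 0 else S k.

Lemma unfresh_lift (f : form) (n : nat) :
  vars_below n f -> ren (unfresh n) f = lift f.
Proof.
  intros H; apply ren_ext_below with n; auto.
  intros k Hk; unfold unfresh; destruct (Nat.eqb_spec k n); lia.
Qed.

Lemma unfresh_inst (f : form) (n : nat) :
  vars_below (S n) f -> ren (unfresh n) (inst n f) = f.
Proof.
  intros H; unfold inst; rewrite ren_ren.
  rewrite <- (ren_id f (fun k => k)) at 2 by reflexivity.
  apply ren_ext_below with (S n); auto.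
  intros [|k] Hk; unfold unfresh.
  - rewrite Nat.eqb_refl; reflexivity.
  - destruct (Nat.eqb_spec k n); lia.
Qed.

Lemma unfresh_lift_list (G : list form) (n : nat) :
  (forall f, In f G -> vars_below n f) ->
  map (ren (unfresh n)) G = map lift G.
Proof.
  intros H; apply map_ext_in; intros f Hf; apply unfresh_lift; auto.
Qed.

(** A variable occurring nowhere in [G] and [f] is generic, so the rule with
    one premise for each variable is admissible. *)
Lemma prv_allI_inst (G : list form) (f : form) :
  (forall n, prv CZFm G (inst n f)) -> prv CZFm G (All f).
Proof.
  intros H.
  (* A bound [n] for [All f] and [G] makes [n] fresh for both; for the body [f] it is the bound
     [S n]. *)
  destruct (vars_below_bound_list (All f :: G)) as [n Hn].
  apply prv_allI.
  rewrite <- (unfresh_lift_list G n), <- (unfresh_inst f n).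
  - apply prv_ren, H.
  - apply (Hn (All f)); left; reflexivity.
  - intros g Hg; apply Hn; right; exact Hg.
Qed.

Lemma prv_exE_inst (G : list form) (f h : form) :
  prv CZFm G (Ex f) -> (forall n, prv CZFm (inst n f :: G) h) ->
  prv CZFm G h.
Proof.
  intros He H.
  destruct (vars_below_bound_list (Ex f :: h :: G)) as [n Hn].
  apply prv_exE with f; [exact He|].
  rewrite <- (unfresh_lift_list G n), <- (unfresh_lift h n).
  - rewrite <- (unfresh_inst f n) at 1.
    + apply (prv_ren (inst n f :: G)), H.
    + apply (Hn (Ex f)); left; reflexivity.
  - apply Hn; right; left; reflexivity.
  - intros g Hg; apply Hn; right; right; exact Hg.
Qed.

(** * Forcing *)

Definition upn (d : nat) (r : nat -> nat) : nat -> nat := Nat.iter d up r.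

Lemma upn_lt (d k : nat) (r : nat -> nat) : k < d -> upn d r k = k.
Proof.
  revert k; induction d as [|d IH]; intros [|k] H; simpl; try lia.
  rewrite IH; lia.
Qed.

Lemma upn_add (d k : nat) (r : nat -> nat) : upn d r (d + k) = d + r k.
Proof. induction d as [|d IH]; simpl; auto. Qed.

(** [v] below [e] extra binders becomes [v'] under the renaming [r] of these;
    only depths from [k] on matter, as truncated subtraction gives a bound
    variable a junk index outside its binder. *)
Definition var_ren (r : nat -> nat) (e k : nat) (v v' : var) : Prop :=
  forall d, k <= d -> upn d r (v (d + e)) = v' d.

Definition pform_ren (r : nat -> nat) (e k : nat) (F F' : pform) : Prop :=
  forall d, k <= d -> ren (upn d r) (F (d + e)) = F' d.

(** [r] sends the parameters, as seen at depth [e], to those at depth [0]. *)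
Definition fixes_par (r : nat -> nat) (e : nat) : Prop :=
  forall i, r (e + i) = i.

(** The type [var -> pform] also contains functions that inspect the depth or the index of their
    argument. Naturality is the parametricity condition that excludes them: related variables give
    related formulas. *)
Definition natural1 (F : var -> pform) : Prop :=
  forall r e k v v', fixes_par r e -> var_ren r e k v v' ->
    pform_ren r e k (F v) (F v').

Definition natural2 (F : var -> var -> pform) : Prop :=
  forall r e k v v' w w', fixes_par r e ->
    var_ren r e k v v' -> var_ren r e k w w' ->
    pform_ren r e k (F v w) (F v' w').

Lemma var_ren_le r e k k' v v' :
  var_ren r e k v v' -> k <= k' -> var_ren r e k' v v'.
Proof. intros H I d Hd; apply H; lia. Qed.

Lemma var_ren_par r e k i : fixes_par r e -> var_ren r e k (par i) (par i).
Proof.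
  intros H d _; unfold par; rewrite <- Nat.add_assoc, upn_add, H; reflexivity.
Qed.

Section Connectives.
  Variables (r : nat -> nat) (e k : nat).

  Lemma ren_fEq v v' w w' :
    var_ren r e k v v' -> var_ren r e k w w' ->
    pform_ren r e k (v ≐ w) (v' ≐ w').
  Proof. intros H1 H2 d Hd; unfold fEq; simpl; rewrite H1, H2; auto. Qed.

  Lemma ren_fMem v v' w w' :
    var_ren r e k v v' -> var_ren r e k w w' ->
    pform_ren r e k (v ∈ w) (v' ∈ w').
  Proof. intros H1 H2 d Hd; unfold fMem; simpl; rewrite H1, H2; auto. Qed.

  Lemma ren_fAnd F F' H H' :
    pform_ren r e k F F' -> pform_ren r e k H H' ->
    pform_ren r e k (F ∧ H) (F' ∧ H').
  Proof. intros H1 H2 d Hd; unfold fAnd; simpl; rewrite H1, H2; auto. Qed.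

  Lemma ren_fOr F F' H H' :
    pform_ren r e k F F' -> pform_ren r e k H H' ->
    pform_ren r e k (F ∨ H) (F' ∨ H').
  Proof. intros H1 H2 d Hd; unfold fOr; simpl; rewrite H1, H2; auto. Qed.

  Lemma ren_fImp F F' H H' :
    pform_ren r e k F F' -> pform_ren r e k H H' ->
    pform_ren r e k (F → H) (F' → H').
  Proof. intros H1 H2 d Hd; unfold fImp; simpl; rewrite H1, H2; auto. Qed.

  (** From depth [S d] on, the bound variable has an index smaller than the number of binders
      crossed, and [upn] fixes such indices. At smaller depths its index is junk, so the threshold
      rises to [S d]. *)
  Lemma ren_binder F F' d :
    (forall k' v v', k <= k' -> var_ren r e k' v v' ->
       pform_ren r e k' (F v) (F' v')) -> k <= d ->
    ren (upn (S d) r) (F (fun d' => d' - S (d + e)) (S (d + e))) =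
    F' (fun d' => d' - S d) (S d).
  Proof.
    intros H Hd.
    apply (H (S d) (fun d' => d' - S (d + e)) (fun d' => d' - S d));
      [lia| |lia].
    intros d' Hd'; rewrite upn_lt; lia.
  Qed.

  Lemma ren_fAll F F' :
    (forall k' v v', k <= k' -> var_ren r e k' v v' ->
       pform_ren r e k' (F v) (F' v')) ->
    pform_ren r e k (fAll F) (fAll F').
  Proof.
    intros H d Hd; unfold fAll; simpl; f_equal; apply (ren_binder F F'); auto.
  Qed.

  Lemma ren_fEx F F' :
    (forall k' v v', k <= k' -> var_ren r e k' v v' ->
       pform_ren r e k' (F v) (F' v')) ->
    pform_ren r e k (fEx F) (fEx F').
  Proof.
    intros H d Hd; unfold fEx; simpl; f_equal; apply (ren_binder F F'); auto.
  Qed.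
End Connectives.

Lemma natural_rel (f : form) : natural2 (rel f).
Proof.
  intros r e k v v' w w' Hr Hv Hw d Hd; unfold rel; rewrite ren_ren.
  apply ren_ext; intros [|[|i]]; auto.
  rewrite <- Nat.add_assoc, upn_add, Hr; reflexivity.
Qed.

Lemma natural_cls (f : form) : natural1 (cls f).
Proof.
  intros r e k v v' Hr Hv d Hd; unfold cls; rewrite ren_ren.
  apply ren_ext; intros [|i]; auto.
  rewrite <- Nat.add_assoc, upn_add, Hr; reflexivity.
Qed.

Ltac natural :=
  match goal with
  | |- natural1 _ => intros ? ? ? ? ? ? ?; natural
  | |- natural2 _ => intros ? ? ? ? ? ? ? ? ? ?; natural
  | |- forall _, _ => intros; natural
  | |- var_ren _ _ _ (par _) _ => apply var_ren_par; assumption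
  | |- var_ren _ _ _ _ _ => eapply var_ren_le; [eassumption|lia]
  | |- pform_ren _ _ _ _ _ =>
      first
        [ apply natural_cls; [assumption|natural]
        | apply natural_rel; [assumption|natural|natural]
        | match goal with
          | H : natural2 ?F |- pform_ren _ _ _ (?F _ _) _ =>
              apply H; [assumption|natural|natural]
          | H : natural1 ?F |- pform_ren _ _ _ (?F _) _ =>
              apply H; [assumption|natural]
          end
        | apply ren_fEq; natural
        | apply ren_fMem; natural
        | apply ren_fAnd; natural
        | apply ren_fOr; natural
        | apply ren_fImp; natural
        | apply ren_fAll; natural
        | apply ren_fEx; natural ]
  end.

(** The left side instantiates the body of [fAll F] or [fEx F] at depth [0]. The equation is
    naturality across one extra binder, with the substitution itself as the renaming. *)
Lemma natural_inst (F : var -> pform) (n : nat) :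
  natural1 F -> inst n (F (fun d => d - 1) 1) = F (par n) 0.
Proof.
  intros H.
  refine (H (fun k => match k with 0 => n | S i => i end) 1 0
            (fun d => d - 1) (par n) _ _ 0 (le_n 0)).
  - intros i; reflexivity.
  - intros d _; replace (d + 1 - 1) with (d + 0) by lia; apply upn_add.
Qed.

(** * Forcing clauses for connectives, quantifiers and equality *)

Definition holds (G : list form) (F : pform) : Prop := prv CZFm G (F 0).

Notation "G ⊩ F" := (holds G F%pform) (at level 100, F at level 200).

Lemma holds_incl G G' F : incl G G' -> (G ⊩ F) -> G' ⊩ F.
Proof. intros I H; apply (prv_incl _ _ _ H _ I). Qed.

(** The Kripke clause for implication; the world to look at is [G] extended by the antecedent. *)
Lemma imp_intro G F H :
  (forall G', incl G G' -> (G' ⊩ F) -> G' ⊩ H) -> G ⊩ F → H.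
Proof.
  intros K; apply prv_impI, (K (F 0 :: G)).
  - intros f Hf; right; exact Hf.
  - apply prv_hyp; left; reflexivity.
Qed.

Lemma imp_elim G F H : (G ⊩ F → H) -> (G ⊩ F) -> G ⊩ H.
Proof. apply prv_impE. Qed.

Lemma and_intro G F H : (G ⊩ F) -> (G ⊩ H) -> G ⊩ F ∧ H.
Proof. apply prv_andI. Qed.

Lemma and_elim G F H : (G ⊩ F ∧ H) -> (G ⊩ F) /\ (G ⊩ H).
Proof.
  intros K; split; [eapply prv_andE1, K|eapply prv_andE2, K].
Qed.

Lemma or_left G F H : (G ⊩ F) -> G ⊩ F ∨ H.
Proof. apply prv_orI1. Qed.

Lemma or_right G F H : (G ⊩ H) -> G ⊩ F ∨ H.
Proof. apply prv_orI2. Qed.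

(** A world may force a disjunction without forcing either disjunct, so cases are split only towards
    a forced goal, in larger worlds. The same holds for witnesses in [exists_elim]. *)
Lemma or_elim G F H K :
  (G ⊩ F ∨ H) ->
  (forall G', incl G G' -> (G' ⊩ F) -> G' ⊩ K) ->
  (forall G', incl G G' -> (G' ⊩ H) -> G' ⊩ K) -> G ⊩ K.
Proof.
  intros O K1 K2; apply (prv_orE _ _ _ _ _ O); [apply K1|apply K2];
    try (apply prv_hyp; left; reflexivity); intros f Hf; right; exact Hf.
Qed.

Lemma iff_elim G F H : (G ⊩ F ↔ H) -> (G ⊩ F) <-> (G ⊩ H).
Proof.
  intros K; apply and_elim in K as [K1 K2]; split; apply imp_elim; assumption.
Qed.

Lemma forall_intro G F :
  natural1 F -> (forall n, G ⊩ F (par n)) -> G ⊩ fAll F.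
Proof.
  intros N H; apply prv_allI_inst; intros n.
  rewrite (natural_inst F n N); apply H.
Qed.

Lemma forall_elim G F : natural1 F -> (G ⊩ fAll F) -> forall n, G ⊩ F (par n).
Proof.
  intros N H n; unfold holds; rewrite <- (natural_inst F n N).
  apply prv_allE, H.
Qed.

Lemma exists_intro G F n : natural1 F -> (G ⊩ F (par n)) -> G ⊩ fEx F.
Proof.
  intros N H; apply prv_exI with n.
  rewrite (natural_inst F n N); apply H.
Qed.

Lemma exists_elim G F H :
  natural1 F -> (G ⊩ fEx F) ->
  (forall n G', incl G G' -> (G' ⊩ F (par n)) -> G' ⊩ H) -> G ⊩ H.
Proof.
  intros N E K; apply (prv_exE_inst _ _ _ E); intros n.
  apply (K n).
  - intros f Hf; right; exact Hf.
  - unfold holds; rewrite <- (natural_inst F n N).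
    apply prv_hyp; left; reflexivity.
Qed.

Lemma holds_eq_refl G x : G ⊩ par x ≐ par x.
Proof. apply prv_eqI. Qed.

Lemma holds_eq_subst G F x y :
  natural1 F -> (G ⊩ par x ≐ par y) -> (G ⊩ F (par x)) -> G ⊩ F (par y).
Proof.
  intros N E H; unfold holds; rewrite <- (natural_inst F y N).
  apply prv_eqE with x; [exact E|].
  rewrite (natural_inst F x N); exact H.
Qed.

Lemma holds_eq_sym G x y : (G ⊩ par x ≐ par y) -> G ⊩ par y ≐ par x.
Proof.
  intros E.
  apply (holds_eq_subst G (fun z => z ≐ par x) x y);
    [natural|exact E|apply holds_eq_refl].
Qed.

Lemma holds_eq_trans G x y z :
  (G ⊩ par x ≐ par y) -> (G ⊩ par y ≐ par z) -> G ⊩ par x ≐ par z.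
Proof.
  intros E1 E2.
  apply (holds_eq_subst G (fun z => par x ≐ z) y z);
    [natural|exact E2|exact E1].
Qed.

(** Monotonicity moves every forced fact to the larger world, which then takes over the old name, so
    that a proof has one current world. *)
Ltac enlarge I :=
  match type of I with
  | incl ?G ?G' =>
      repeat match goal with
        | H : holds G _ |- _ => apply (holds_incl _ _ _ I) in H
        end;
      clear I; clear G; rename G' into G
  end.

Ltac clear_hyp E := tryif is_var E then clear E else idtac.

Tactic Notation "fintro" ident(H) :=
  apply imp_intro;
  let G' := fresh "G'" in let I := fresh "I" in intros G' I H; enlarge I.

Tactic Notation "fintro_all" ident(x) :=
  apply forall_intro; [natural|intros x; cbv beta].

Tactic Notation "fexists" constr(x) :=
  apply exists_intro with x; [natural|cbv beta].

Tactic Notation "fdestruct_ex" constr(E) "as" ident(x) ident(H) :=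
  apply (fun N => exists_elim _ _ _ N E); [natural|]; clear_hyp E;
  let G' := fresh "G'" in let I := fresh "I" in intros x G' I H;
  cbv beta in H; enlarge I.

Tactic Notation "fdestruct_or" constr(E) "as" ident(H) :=
  apply (or_elim _ _ _ _ E); clear_hyp E;
  let G' := fresh "G'" in let I := fresh "I" in intros G' I H; enlarge I.

Tactic Notation "fdestruct_and" constr(E) "as" ident(H1) ident(H2) :=
  let T := fresh in
  pose proof (and_elim _ _ _ E) as T; clear_hyp E; destruct T as [H1 H2].

Tactic Notation "fspec" constr(E) constr(x) "as" ident(H) :=
  assert (H := fun N => forall_elim _ _ N E x);
  match type of H with ?N -> _ =>
    let T := fresh in assert (T : N) by natural; specialize (H T); clear T end;
  cbv beta in H.

(** * Set Induction and Strong Collection for natural predicates *)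

(** The schemes speak of de Bruijn formulas. The body of [F] at depth [1], with its argument as
    variable [0], is the formula that represents [F] there. *)
Lemma cls_natural (F : var -> pform) x :
  natural1 F -> cls (F (fun d => d - 1) 1) (par x) 0 = F (par x) 0.
Proof.
  intros N; rewrite <- (natural_inst F x N); unfold inst, cls, par.
  apply ren_ext; intros [|i]; reflexivity.
Qed.

(** At depth [2] the variables [d - 2] and [d - 1] have indices [0] and [1], the places where [rel]
    expects its first and second argument. *)
Lemma rel_natural (R : var -> var -> pform) x y :
  natural2 R ->
  rel (R (fun d => d - 2) (fun d => d - 1) 2) (par x) (par y) 0 =
  R (par x) (par y) 0.
Proof.
  intros N.
  refine (N (fun k => match k with 0 => x | 1 => y | S (S i) => i end) 2 0
            (fun d => d - 2) (par x) (fun d => d - 1) (par y) _ _ _ 0 (le_n 0)).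
  - intros i; reflexivity.
  - intros d _; replace (d + 2 - 2) with (d + 0) by lia; apply upn_add.
  - intros d _; replace (d + 2 - 1) with (d + 1) by lia; apply upn_add.
Qed.

Lemma set_induction G (F : var -> pform) :
  natural1 F ->
  (G ⊩ ∀ a, (∀ x, x ∈ a → F x) → F a) -> G ⊩ ∀ a, F a.
Proof.
  intros N H.
  (* Stated for every world, because it is applied after hypotheses have enlarged the current
     one. *)
  assert (E : forall G x, (G ⊩ cls (F (fun d => d - 1) 1) (par x)) <->
                          (G ⊩ F (par x))).
  { intros G1 x; unfold holds; rewrite cls_natural; [reflexivity|exact N]. }
  assert (K : G ⊩ ∀ a, cls (F (fun d => d - 1) 1) a).
  { apply (imp_elim _ _ _ (prv_thy _ _ _ (ax_ind (F (fun d => d - 1) 1)))).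
    fintro_all a. fintro Ha. apply E.
    fspec H a as Ka. apply (imp_elim _ _ _ Ka).
    fintro_all x. fintro Hx.
    fspec Ha x as Kx. apply E, (imp_elim _ _ _ Kx Hx). }
  fintro_all a. fspec K a as Ka. apply E, Ka.
Qed.

Lemma strong_collection G (R : var -> var -> pform) a :
  natural2 R ->
  (G ⊩ ∀ x, x ∈ par a → ∃ y, R x y) ->
  G ⊩ ∃ b, (∀ x, x ∈ par a → ∃ y, y ∈ b ∧ R x y) ∧
           (∀ y, y ∈ b → ∃ x, x ∈ par a ∧ R x y).
Proof.
  intros N H.
  set (f := R (fun d => d - 2) (fun d => d - 1) 2).
  assert (E : forall G x y, (G ⊩ rel f (par x) (par y)) <->
                            (G ⊩ R (par x) (par y))).
  { intros G1 x y; unfold holds, f; rewrite rel_natural;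
      [reflexivity|exact N]. }
  assert (K : G ⊩ StrongCollection f) by apply prv_thy, ax_coll.
  unfold StrongCollection in K.
  fspec K a as Ka.
  assert (H' : G ⊩ ∀ x, x ∈ par a → ∃ y, rel f x y).
  { fintro_all x. fintro Hx. fspec H x as Kx.
    fdestruct_ex (imp_elim _ _ _ Kx Hx) as y Hy.
    fexists y. apply E, Hy. }
  fdestruct_ex (imp_elim _ _ _ Ka H') as b Hb.
  fdestruct_and Hb as Hb1 Hb2.
  fexists b. apply and_intro.
  - fintro_all x. fintro Hx. fspec Hb1 x as Kx.
    fdestruct_ex (imp_elim _ _ _ Kx Hx) as y Hy.
    fdestruct_and Hy as Hy1 Hy2.
    fexists y. apply and_intro; [exact Hy1|apply E, Hy2].
  - fintro_all y. fintro Hy. fspec Hb2 y as Ky.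
    fdestruct_ex (imp_elim _ _ _ Ky Hy) as x Hx.
    fdestruct_and Hx as Hx1 Hx2.
    fexists x. apply and_intro; [exact Hx1|apply E, Hx2].
Qed.

(** * Derivability from rules with sets of premises *)

Lemma set_ext G a b :
  (G ⊩ ∀ x, x ∈ par a ↔ x ∈ par b) -> G ⊩ par a ≐ par b.
Proof.
  assert (K : G ⊩ Extensionality) by apply prv_thy, ax_ext.
  unfold Extensionality in K.
  fspec K a as Ka. fspec Ka b as Kb. apply imp_elim, Kb.
Qed.

Lemma upair_exists G a b : G ⊩ ∃ c, is_upair c (par a) (par b).
Proof.
  assert (K : G ⊩ Pairing) by apply prv_thy, ax_pair.
  unfold Pairing in K.
  fspec K a as Ka. fspec Ka b as Kb. exact Kb.
Qed.

Lemma union_exists G a : G ⊩ ∃ b, ∀ x, x ∈ b ↔ (∃ y, y ∈ par a ∧ x ∈ y).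
Proof.
  assert (K : G ⊩ Union) by apply prv_thy, ax_union.
  unfold Union in K. fspec K a as Ka. exact Ka.
Qed.

Lemma in_upair G c a b x :
  (G ⊩ is_upair (par c) (par a) (par b)) ->
  (G ⊩ par x ∈ par c) <-> (G ⊩ par x ≐ par a ∨ par x ≐ par b).
Proof. intros H. fspec H x as Hx. exact (iff_elim _ _ _ Hx). Qed.

Lemma in_singleton G c a x :
  (G ⊩ is_upair (par c) (par a) (par a)) ->
  (G ⊩ par x ∈ par c) -> G ⊩ par x ≐ par a.
Proof.
  intros H Hx. apply (in_upair _ _ _ _ _ H) in Hx.
  fdestruct_or Hx as E; exact E.
Qed.

Lemma upair_left G c a b :
  (G ⊩ is_upair (par c) (par a) (par b)) -> G ⊩ par a ∈ par c.
Proof.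
  intros H. apply (in_upair _ _ _ _ _ H), or_left, holds_eq_refl.
Qed.

Lemma upair_right G c a b :
  (G ⊩ is_upair (par c) (par a) (par b)) -> G ⊩ par b ∈ par c.
Proof.
  intros H. apply (in_upair _ _ _ _ _ H), or_right, holds_eq_refl.
Qed.

(** By Extensionality, equality with a given pair and the property of being that pair are
    interchangeable; this reduces ordered pairs to unordered pairs of sets. *)
Lemma eq_upair G c d a b :
  (G ⊩ is_upair (par c) (par a) (par b)) ->
  (G ⊩ par d ≐ par c) <-> (G ⊩ is_upair (par d) (par a) (par b)).
Proof.
  intros H; split; intros K.
  - apply (holds_eq_subst G (fun z => is_upair z (par a) (par b)) c d);
      [natural|apply holds_eq_sym, K|exact H].
  - apply set_ext. fintro_all x. apply and_intro.
    + fintro Hx. apply (in_upair _ _ _ _ _ H), (in_upair _ _ _ _ _ K), Hx.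
    + fintro Hx. apply (in_upair _ _ _ _ _ K), (in_upair _ _ _ _ _ H), Hx.
Qed.

Lemma in_opair G p a b x :
  (G ⊩ is_opair (par p) (par a) (par b)) ->
  (G ⊩ par x ∈ par p) <->
  (G ⊩ is_upair (par x) (par a) (par a) ∨ is_upair (par x) (par a) (par b)).
Proof. intros H. fspec H x as Hx. exact (iff_elim _ _ _ Hx). Qed.

Lemma opair_exists G a b : G ⊩ ∃ p, is_opair p (par a) (par b).
Proof.
  fdestruct_ex (upair_exists G a a) as u Hu.
  fdestruct_ex (upair_exists G a b) as w Hw.
  fdestruct_ex (upair_exists G u w) as p Hp.
  fexists p. fintro_all x. apply and_intro.
  - fintro Hx. apply (in_upair _ _ _ _ _ Hp) in Hx.
    fdestruct_or Hx as E.
    + apply or_left, (eq_upair _ _ _ _ _ Hu), E.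
    + apply or_right, (eq_upair _ _ _ _ _ Hw), E.
  - fintro Hx. apply (in_upair _ _ _ _ _ Hp).
    fdestruct_or Hx as E.
    + apply or_left, (eq_upair _ _ _ _ _ Hu), E.
    + apply or_right, (eq_upair _ _ _ _ _ Hw), E.
Qed.

(** The element {a} of [p] is {a'} or {a', b'}; either way it contains [a']. *)
Lemma opair_fst G p a b a' b' :
  (G ⊩ is_opair (par p) (par a) (par b)) ->
  (G ⊩ is_opair (par p) (par a') (par b')) -> G ⊩ par a ≐ par a'.
Proof.
  intros H H'.
  fdestruct_ex (upair_exists G a a) as u Hu.
  assert (K : G ⊩ par u ∈ par p) by apply (in_opair _ _ _ _ _ H), or_left, Hu.
  apply (in_opair _ _ _ _ _ H') in K.
  fdestruct_or K as E; apply holds_eq_sym, (in_singleton _ _ _ _ Hu);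
    exact (upair_left _ _ _ _ E).
Qed.

Lemma in_opair_snd G p a b a' b' :
  (G ⊩ is_opair (par p) (par a) (par b)) ->
  (G ⊩ is_opair (par p) (par a') (par b')) ->
  G ⊩ par b ≐ par a' ∨ par b ≐ par b'.
Proof.
  intros H H'.
  fdestruct_ex (upair_exists G a b) as w Hw.
  assert (K : G ⊩ par w ∈ par p) by apply (in_opair _ _ _ _ _ H), or_right, Hw.
  apply (in_opair _ _ _ _ _ H') in K.
  fdestruct_or K as E.
  - apply or_left, (in_singleton _ _ _ _ E), (upair_right _ _ _ _ Hw).
  - apply (in_upair _ _ _ _ _ E), (upair_right _ _ _ _ Hw).
Qed.

Lemma opair_snd G p a b a' b' :
  (G ⊩ is_opair (par p) (par a) (par b)) ->
  (G ⊩ is_opair (par p) (par a') (par b')) -> G ⊩ par b ≐ par b'.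
Proof.
  intros H H'.
  pose proof (opair_fst _ _ _ _ _ _ H H') as Ea.
  fdestruct_or (in_opair_snd _ _ _ _ _ _ H H') as E; [|exact E].
  fdestruct_or (in_opair_snd _ _ _ _ _ _ H' H) as E'; [|apply holds_eq_sym, E'].
  (* In the crossed case b = a' and b' = a, so b = a' = a = b'. No decision whether a = b is made,
     as befits intuitionistic logic. *)
  exact (holds_eq_trans _ _ _ _ E
    (holds_eq_trans _ _ _ _ (holds_eq_sym _ _ _ Ea) (holds_eq_sym _ _ _ E'))).
Qed.

Lemma related_opair G g p a b :
  (G ⊩ is_opair (par p) (par a) (par b)) -> (G ⊩ par p ∈ par g) ->
  G ⊩ related (elems (par g)) (par a) (par b).
Proof. intros H K. fexists p. apply and_intro; assumption. Qed.

(** Injectivity of ordered pairs identifies the components supplied by [sub_prod] with [a] and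
    [b]. *)
Lemma sub_prod_related G (R A B : class) a b :
  natural1 R -> natural1 A -> natural1 B ->
  (G ⊩ sub_prod R A B) -> (G ⊩ related R (par a) (par b)) ->
  G ⊩ A (par a) ∧ B (par b).
Proof.
  intros NR NA NB H K.
  fdestruct_ex K as p Hp. fdestruct_and Hp as Hp Rp.
  fspec H p as Hq.
  fdestruct_ex (imp_elim _ _ _ Hq Rp) as a' Ha.
  fdestruct_ex Ha as b' Hb.
  fdestruct_and Hb as Aa Hb. fdestruct_and Hb as Bb Hp'.
  apply and_intro.
  - exact (holds_eq_subst _ A _ _ NA (opair_fst _ _ _ _ _ _ Hp' Hp) Aa).
  - exact (holds_eq_subst _ B _ _ NB (opair_snd _ _ _ _ _ _ Hp' Hp) Bb).
Qed.

(** The set [g] is the union of {h, {p}}. *)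
Lemma adjoin_exists G h p : G ⊩ ∃ g, ∀ q, q ∈ g ↔ q ∈ par h ∨ q ≐ par p.
Proof.
  fdestruct_ex (upair_exists G p p) as s Hs.
  fdestruct_ex (upair_exists G h s) as c Hc.
  fdestruct_ex (union_exists G c) as g Hg.
  fexists g. fintro_all q. fspec Hg q as Hq.
  apply and_intro.
  - fintro K. apply (iff_elim _ _ _ Hq) in K.
    fdestruct_ex K as y Hy. fdestruct_and Hy as Hy Hqy.
    apply (in_upair _ _ _ _ _ Hc) in Hy.
    fdestruct_or Hy as E.
    + apply or_left.
      exact (holds_eq_subst G (fun z => par q ∈ z) y h ltac:(natural) E Hqy).
    + apply or_right, (in_singleton _ _ _ _ Hs).
      exact (holds_eq_subst G (fun z => par q ∈ z) y s ltac:(natural) E Hqy).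
  - fintro K. apply (iff_elim _ _ _ Hq). fdestruct_or K as E.
    + fexists h. apply and_intro; [exact (upair_left _ _ _ _ Hc)|exact E].
    + fexists s. apply and_intro; [exact (upair_right _ _ _ _ Hc)|].
      apply (in_upair _ _ _ _ _ Hs), or_left, E.
Qed.

(** * Good sets and derivable elements *)

(** Here [R X y] means that some rule has the set of premises [X] and the conclusion [y]. Any set
    may serve as a stage; only its members count. *)
Definition good (R : var -> var -> pform) (g : var) : pform :=
  ∀ a y, related (elems g) a y →
    ∃ X, R X y ∧ (∀ x, x ∈ X → ∃ c, c ∈ a ∧ related (elems g) c x).

Definition derivable (R : var -> var -> pform) (y : var) : pform :=
  ∃ g, good R g ∧ (∃ a, related (elems g) a y).

Lemma related_mono G g h a b :
  (G ⊩ ∀ p, p ∈ par g → p ∈ par h) ->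
  (G ⊩ related (elems (par g)) (par a) (par b)) ->
  G ⊩ related (elems (par h)) (par a) (par b).
Proof.
  intros S H. fdestruct_ex H as p Hp. fdestruct_and Hp as H1 H2.
  fspec S p as Sp.
  exact (related_opair _ _ _ _ _ H1 (imp_elim _ _ _ Sp H2)).
Qed.

(** A justification found in [g] persists in any larger [h], since its premises are only required to
    occur. Both ways of building good sets, union and adjunction, rest on this. *)
Lemma good_step G R g h a y :
  natural2 R -> (G ⊩ good R (par g)) ->
  (G ⊩ ∀ p, p ∈ par g → p ∈ par h) ->
  (G ⊩ related (elems (par g)) (par a) (par y)) ->
  G ⊩ ∃ X, R X (par y) ∧
    (∀ x, x ∈ X → ∃ c, c ∈ par a ∧ related (elems (par h)) c x).
Proof.
  intros N Hg S H. unfold good in Hg.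
  fspec Hg a as K. fspec K y as K'.
  fdestruct_ex (imp_elim _ _ _ K' H) as X HX.
  fdestruct_and HX as HR HX.
  fexists X. apply and_intro; [exact HR|].
  fintro_all x. fintro Hx. fspec HX x as Kx.
  fdestruct_ex (imp_elim _ _ _ Kx Hx) as c Hc.
  fdestruct_and Hc as Hc1 Hc2.
  fexists c. apply and_intro; [exact Hc1|].
  exact (related_mono _ _ _ _ _ S Hc2).
Qed.

Lemma good_union G R s u :
  natural2 R -> (G ⊩ ∀ g, g ∈ par s → good R g) ->
  (G ⊩ ∀ p, p ∈ par u ↔ (∃ g, g ∈ par s ∧ p ∈ g)) ->
  G ⊩ good R (par u).
Proof.
  intros N Hs Hu. unfold good in Hs |- *.
  fintro_all a. fintro_all y. fintro H.
  fdestruct_ex H as p Hp. fdestruct_and Hp as Hp Hpu.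
  fspec Hu p as Kp. apply (iff_elim _ _ _ Kp) in Hpu.
  fdestruct_ex Hpu as g Hg. fdestruct_and Hg as Hg Hpg.
  fspec Hs g as Ks.
  apply (good_step G R g u a y N (imp_elim _ _ _ Ks Hg)).
  - fintro_all q. fintro Hq. fspec Hu q as Kq. apply (iff_elim _ _ _ Kq).
    fexists g. apply and_intro; assumption.
  - exact (related_opair _ _ _ _ _ Hp Hpg).
Qed.

Lemma good_adjoin G R h p g a y X :
  natural2 R -> (G ⊩ good R (par h)) ->
  (G ⊩ is_opair (par p) (par a) (par y)) ->
  (G ⊩ ∀ q, q ∈ par g ↔ q ∈ par h ∨ q ≐ par p) ->
  (G ⊩ R (par X) (par y)) ->
  (G ⊩ ∀ x, x ∈ par X → ∃ c, c ∈ par a ∧ related (elems (par h)) c x) ->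
  G ⊩ good R (par g).
Proof.
  intros N Hh Hp Hg HR HX.
  assert (S : G ⊩ ∀ q, q ∈ par h → q ∈ par g).
  { fintro_all q. fintro Hq. fspec Hg q as Kq.
    apply (iff_elim _ _ _ Kq), or_left, Hq. }
  unfold good. fintro_all a'. fintro_all y'. fintro H.
  fdestruct_ex H as q Hq. fdestruct_and Hq as Hq Hqg.
  fspec Hg q as Kq. apply (iff_elim _ _ _ Kq) in Hqg.
  fdestruct_or Hqg as E.
  - apply (good_step G R h g a' y' N Hh S).
    exact (related_opair _ _ _ _ _ Hq E).
  (* The pair is the adjoined one, so its components equal [a] and [y], and the rule with premises
     [X] justifies it. *)
  - assert (Hp' : G ⊩ is_opair (par p) (par a') (par y')) by
      exact (holds_eq_subst G (fun z => is_opair z (par a') (par y')) q p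
               ltac:(natural) E Hq).
    pose proof (opair_fst _ _ _ _ _ _ Hp Hp') as Ea.
    pose proof (opair_snd _ _ _ _ _ _ Hp Hp') as Ey.
    fexists X. apply and_intro.
    + exact (holds_eq_subst G (fun z => R (par X) z) y y' ltac:(natural) Ey HR).
    + fintro_all x. fintro Hx. fspec HX x as Kx.
      fdestruct_ex (imp_elim _ _ _ Kx Hx) as c Hc.
      fdestruct_and Hc as Hc1 Hc2.
      fexists c. apply and_intro.
      * exact (holds_eq_subst G (fun z => par c ∈ z) a a'
                 ltac:(natural) Ea Hc1).
      * exact (related_mono _ _ _ _ _ S Hc2).
Qed.

Lemma derivable_closed G R X y :
  natural2 R -> (G ⊩ R (par X) (par y)) ->
  (G ⊩ ∀ x, x ∈ par X → derivable R x) -> G ⊩ derivable R (par y).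
Proof.
  intros N HR H. unfold derivable, good in H |- *.
  (* Good sets are collected without choice: the first clause of Strong Collection provides one for
     each premise, and the second makes every member of [s] good, hence also the union [h]. *)
  apply (strong_collection G (fun x g => good R g ∧
    (∃ a, related (elems g) a x)) X) in H; [|natural].
  fdestruct_ex H as s Hs. fdestruct_and Hs as Hs1 Hs2.
  fdestruct_ex (union_exists G s) as h Hh.
  assert (Gh : G ⊩ good R (par h)).
  { apply (good_union G R s h N); [|exact Hh].
    fintro_all g. fintro Hg. fspec Hs2 g as Kg.
    fdestruct_ex (imp_elim _ _ _ Kg Hg) as x Hx.
    fdestruct_and Hx as Hx1 Hx2. fdestruct_and Hx2 as Hx2 Hx3. exact Hx2. }
  assert (K : G ⊩ ∀ x, x ∈ par X → ∃ a, related (elems (par h)) a x).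
  { fintro_all x. fintro Hx. fspec Hs1 x as Kx.
    fdestruct_ex (imp_elim _ _ _ Kx Hx) as g Hg.
    fdestruct_and Hg as Hg Hg'. fdestruct_and Hg' as _Hg Ha.
    fdestruct_ex Ha as a Ha. fexists a.
    apply (related_mono _ g); [|exact Ha].
    fintro_all p. fintro Hp. fspec Hh p as Kp. apply (iff_elim _ _ _ Kp).
    fexists g. apply and_intro; assumption. }
  (* The collected set [a] contains, for each premise, a stage at which it occurs in [h]. So [a] can
     itself be the stage of the conclusion [y]. *)
  apply (strong_collection G (fun x a => related (elems (par h)) a x) X) in K;
    [|natural].
  fdestruct_ex K as a Ha. fdestruct_and Ha as Ha _Ha.
  fdestruct_ex (opair_exists G a y) as p Hp.
  fdestruct_ex (adjoin_exists G h p) as g Hg.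
  fexists g. apply and_intro.
  - exact (good_adjoin G R h p g a y X N Gh Hp Hg HR Ha).
  - fexists a. apply (related_opair _ _ _ _ _ Hp).
    fspec Hg p as Kp. apply (iff_elim _ _ _ Kp), or_right, holds_eq_refl.
Qed.

Lemma derivable_rule G R y :
  natural2 R -> (G ⊩ derivable R (par y)) -> G ⊩ ∃ X, R X (par y).
Proof.
  intros N H. unfold derivable, good in H.
  fdestruct_ex H as g Hg. fdestruct_and Hg as Hg Ha.
  fdestruct_ex Ha as a Ha.
  fspec Hg a as K. fspec K y as K'.
  fdestruct_ex (imp_elim _ _ _ K' Ha) as X HX.
  fdestruct_and HX as HR _HX. fexists X. exact HR.
Qed.

Lemma derivable_least G R (Y : class) :
  natural2 R -> natural1 Y ->
  (G ⊩ ∀ X y, R X y → subclass (elems X) Y → Y y) ->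
  G ⊩ subclass (derivable R) Y.
Proof.
  intros N NY HY. unfold subclass, derivable, good.
  fintro_all y. fintro H.
  fdestruct_ex H as g Hg. fdestruct_and Hg as Hg Ha.
  fdestruct_ex Ha as a Ha.
  (* Induction on the stage within a fixed good set, for all elements at once: the premises of an
     element at stage [a] occur at members of [a]. *)
  assert (K : G ⊩ ∀ a, (fun a => ∀ y, related (elems (par g)) a y → Y y) a).
  { apply set_induction; [natural|].
    fintro_all b. fintro IH. fintro_all z. fintro Hz.
    fspec Hg b as K1. fspec K1 z as K2.
    fdestruct_ex (imp_elim _ _ _ K2 Hz) as X HX.
    fdestruct_and HX as HR HX.
    unfold subclass in HY.
    fspec HY X as Y1. fspec Y1 z as Y2.
    apply (imp_elim _ _ _ (imp_elim _ _ _ Y2 HR)).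
    fintro_all x. fintro Hx. fspec HX x as Kx.
    fdestruct_ex (imp_elim _ _ _ Kx Hx) as c Hc.
    fdestruct_and Hc as Hc1 Hc2.
    fspec IH c as I1. pose proof (imp_elim _ _ _ I1 Hc1) as I2.
    fspec I2 x as I3. exact (imp_elim _ _ _ I3 Hc2). }
  fspec K a as K1. fspec K1 y as K2. exact (imp_elim _ _ _ K2 Ha).
Qed.

(** * Inductive definitions on set-generated semilattices *)

(** The disjuncts encode closedness under joins and under [Phi] as rules with a set of premises. The
    conjunct [b ∈ B] keeps all conclusions inside [B]. In the second disjunct [X] may be any set
    that includes [down le B a]. *)
Definition closure_rule (L le : class) (B : var) (Phi : class)
    (X b : var) : pform :=
  b ∈ B ∧
  ((∃ s, is_sup L le (elems X) s ∧ related le b s) ∨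
   (∃ a, related Phi b a ∧ subclass (down le B a) (elems X))).

Lemma natural_closure_rule (L le Phi : class) B :
  natural1 L -> natural1 le -> natural1 Phi ->
  natural2 (closure_rule L le (par B) Phi).
Proof. intros NL Nle NPhi. natural. Qed.

(** The class [I] agrees with [derivable R] at every world but may be written differently, so that
    it can later be a class given by a formula. *)
Lemma derivable_Phi_closed G (L le Phi I : class) B :
  natural1 L -> natural1 le -> natural1 Phi -> natural1 I ->
  let R := closure_rule L le (par B) Phi in
  (forall G x, (G ⊩ I (par x)) <-> (G ⊩ derivable R (par x))) ->
  (G ⊩ set_generated L le (par B)) ->
  (G ⊩ inductive_definition L (par B) Phi) ->
  G ⊩ Phi_closed L le (par B) Phi I.
Proof.
  intros NL Nle NPhi NI R E HL HPhi.
  assert (NR : natural2 R) by (apply natural_closure_rule; assumption).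
  unfold Phi_closed, c_closed. repeat apply and_intro.
  - fintro_all b. fintro Hb. apply E in Hb.
    fdestruct_ex (derivable_rule _ _ _ NR Hb) as X HX.
    fdestruct_and HX as HB _HX. exact HB.
  - fintro_all U. fintro HU. fintro_all s. fintro Hs. fintro_all b. fintro Hb.
    fdestruct_and Hb as HB Hbs.
    apply E, (derivable_closed G R U b NR).
    + apply and_intro; [exact HB|]. apply or_left.
      fexists s. apply and_intro; assumption.
    + fintro_all x. fintro Hx. fspec HU x as Kx.
      apply E, (imp_elim _ _ _ Kx Hx).
  - fintro_all b. fintro_all a. fintro Hba. fintro Ha.
    pose proof (sub_prod_related _ _ (elems (par B)) _ _ _ NPhi ltac:(natural)
      NL HPhi Hba) as K.
    fdestruct_and K as HB La.
    fdestruct_and HL as _HL HL. fdestruct_and HL as _HB HL.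
    fspec HL a as Ka. pose proof (imp_elim _ _ _ Ka La) as Kb.
    fdestruct_and Kb as Hset _Hsup.
    (* Condition (i) of set generation turns the premises [down le B a] into a set [X], to which
       [derivable_closed] applies. *)
    fdestruct_ex Hset as X HX.
    apply E, (derivable_closed G R X b NR).
    + apply and_intro; [exact HB|]. apply or_right.
      fexists a. apply and_intro; [exact Hba|].
      fintro_all x. fintro Hx. fspec HX x as Kx. apply (iff_elim _ _ _ Kx), Hx.
    + fintro_all x. fintro Hx. fspec HX x as Kx.
      apply (iff_elim _ _ _ Kx) in Hx.
      fspec Ha x as Kx'. apply E, (imp_elim _ _ _ Kx' Hx).
Qed.

(** Supplies the hypothesis of [derivable_least]. A join rule is an instance of closedness under
    joins; for a [Phi] rule, [down le B a] lies in [X] and hence in [Y]. *)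
Lemma Phi_closed_rule G (L le Phi Y : class) B :
  natural1 L -> natural1 le -> natural1 Phi -> natural1 Y ->
  (G ⊩ Phi_closed L le (par B) Phi Y) ->
  G ⊩ ∀ X y, closure_rule L le (par B) Phi X y → subclass (elems X) Y → Y y.
Proof.
  intros NL Nle NPhi NY H. unfold closure_rule.
  fdestruct_and H as Hc HPhi. fdestruct_and Hc as _HB Hc.
  fintro_all X. fintro_all b. fintro HR. fintro HX.
  fdestruct_and HR as HB HR. fdestruct_or HR as K.
  - fdestruct_ex K as s Hs. fdestruct_and Hs as Hs Hbs.
    fspec Hc X as K1. pose proof (imp_elim _ _ _ K1 HX) as K2.
    fspec K2 s as K3. pose proof (imp_elim _ _ _ K3 Hs) as K4.
    fspec K4 b as K5. apply (imp_elim _ _ _ K5).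
    apply and_intro; assumption.
  - fdestruct_ex K as a Ha. fdestruct_and Ha as Hba Ha.
    fspec HPhi b as K1. fspec K1 a as K2.
    apply (imp_elim _ _ _ (imp_elim _ _ _ K2 Hba)).
    fintro_all x. fintro Hx. fspec Ha x as Kx. fspec HX x as Kx'.
    exact (imp_elim _ _ _ Kx' (imp_elim _ _ _ Kx Hx)).
Qed.

Theorem theorem4p3 (L le Phi : form) (B : nat) :
  let hyp := set_generated (cls L) (cls le) (par B) ∧
             inductive_definition (cls L) (par B) (cls Phi) in
  let closed := Phi_closed (cls L) (cls le) (par B) (cls Phi) in
  exists I : form,
    CZFm_proves (hyp → closed (cls I)) /\
    forall Y : form,
      CZFm_proves (hyp → closed (cls Y) → subclass (cls I) (cls Y)).
Proof.
  intros hyp closed.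
  set (R := closure_rule (cls L) (cls le) (par B) (cls Phi)).
  assert (NR : natural2 R) by
    (apply natural_closure_rule; apply natural_cls).
  (* The formula representing [derivable R], with its argument as variable [0], the form that [cls]
     reads. *)
  exists (derivable R (fun d => d - 1) 1).
  assert (E : forall G x,
    (G ⊩ cls (derivable R (fun d => d - 1) 1) (par x)) <->
    (G ⊩ derivable R (par x))).
  { intros G x; unfold holds; rewrite (cls_natural (derivable R));
      [reflexivity|natural]. }
  split; [|intros Y]; unfold CZFm_proves, hyp, closed;
    match goal with |- prv CZFm ?G (?F 0) => change (G ⊩ F) end.
  (* The empty context becomes a variable, since [fintro] replaces the current world by a larger
     one. *)
  - generalize (@nil form) as G; intros G.
    fintro H. fdestruct_and H as HL HPhi.
    apply derivable_Phi_closed; try apply natural_cls; assumption.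
  - generalize (@nil form) as G; intros G.
    fintro H. fintro HY.
    fintro_all x. fintro Hx. apply E in Hx.
    assert (K : G ⊩ subclass (derivable R) (cls Y)).
    { apply (derivable_least G R (cls Y) NR (natural_cls Y)).
      apply Phi_closed_rule; try apply natural_cls; assumption. }
    fspec K x as Kx. exact (imp_elim _ _ _ Kx Hx).
Qed.
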